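(* Let $(\mathcal A_n)_{n\in\mathbb N}$ be a sequence of unital Banach algebras, and let $\mathcal U$ be a non-principal ultrafilter on $\mathbb N$ such that $\{n\in\mathbb N : \mathcal A_n \text{ is Dedekind-finite}\}\in\mathcal U$. Then the ultraproduct $(\mathcal A_n)_{\mathcal U}$ is Dedekind-finite.
   Context: Banach algebras are complex and have a contractive product $\|ab\|\le\|a\|\|b\|$; a unital Banach algebra has unit $1$ with $\|1\|=1$. For a sequence $(\mathcal A_n)$ of Banach algebras, $\ell^\infty(\mathcal A_n)$ is the Banach algebra of all bounded sequences $(a_n)$ with $a_n\in\mathcal A_n$, with pointwise operations and the supremum norm; $c_{\mathcal U}(\mathcal A_n)$ is the closed two-sided ideal of those $(a_n)$ with $\lim_{n\to\mathcal U}\|a_n\|=0$; the ultraproduct is $(\mathcal A_n)_{\mathcal U}=\ell^\infty(\mathcal A_n)/c_{\mathcal U}(\mathcal A_n)$ with the quotient norm. Two idempotents $p,q$ in an algebra $\mathcal A$ are equivalent, $p\sim q$, if there are $a,b\in\mathcal A$ with $p=ab$ and $q=ba$. A unital algebra $\mathcal A$ is Dedekind-finite if every idempotent $p\in\mathcal A$ with $p\sim 1$ satisfies $p=1$. *)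

(* Defs.v *)
From HB Require Import structures.
From mathcomp Require Import all_boot all_order all_algebra.
From mathcomp Require Import complex ring lra.
From mathcomp Require Import all_classical all_reals all_analysis.
Import Order.TTheory GRing.Theory Num.Theory.
Import numFieldNormedType.Exports.
Set Implicit Arguments.
Unset Strict Implicit.
Unset Printing Implicit Defensive.
Local Open Scope classical_set_scope.
Local Open Scope ring_scope.
Local Open Scope complex_scope.
Local Open Scope quotient_scope.

(* The product is a field of the mixin, and the structure inherits only from
   [CompleteNormedModule]: a Hierarchy-Builder join of [GRing.Algebra] and
   [CompleteNormedModule] is rejected because [Num.NumDomain] already joins rings
   and normed modules (with itself as ring of scalars). The [algType] structure
   is recovered below. *)
HB.mixin Record CompleteNormedModule_isUnitalBanachAlgebra (K : numFieldType) A
    of CompleteNormedModule K A := {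
  bmul : A -> A -> A;
  bone : A;
  bmulA : associative bmul;
  bmul1x : left_id bone bmul;
  bmulx1 : right_id bone bmul;
  bmulDl : left_distributive bmul +%R;
  bmulDr : right_distributive bmul +%R;
  bscaleAl : forall (k : K) x y, k *: bmul x y = bmul (k *: x) y;
  bscaleAr : forall (k : K) x y, k *: bmul x y = bmul x (k *: y);
  bnormM : forall x y, `|bmul x y| <= `|x| * `|y|;
  bnorm1 : `|bone| = 1
}.

#[short(type="unitalBanachAlgType")]
HB.structure Definition UnitalBanachAlgebra (K : numFieldType) :=
  {A of CompleteNormedModule_isUnitalBanachAlgebra K A &
        CompleteNormedModule K A}.

Section banach_algebra_algType.
Variables (K : numFieldType) (A : unitalBanachAlgType K).

Lemma bone_neq0 : bone != 0 :> A.
Proof. by rewrite -normr_eq0 bnorm1 oner_eq0. Qed.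

HB.instance Definition _ := GRing.Zmodule_isNzRing.Build A
  bmulA bmul1x bmulx1 bmulDl bmulDr bone_neq0.
HB.instance Definition _ := GRing.Lmodule_isLalgebra.Build K A bscaleAl.
HB.instance Definition _ := GRing.Lalgebra_isAlgebra.Build K A bscaleAr.

Lemma normrM_le (x y : A) : `|x * y| <= `|x| * `|y|.
Proof. exact: bnormM. Qed.

Lemma banach_normr1 : `|1 : A| = 1.
Proof. exact: bnorm1. Qed.

End banach_algebra_algType.

Section dedekind_finite.
Variable A : nzRingType.

Definition idempotent (p : A) : Prop := p * p = p.

Definition idempotent_equiv (p q : A) : Prop :=
  exists a b : A, p = a * b /\ q = b * a.

Definition dedekind_finite : Prop :=
  forall p : A, idempotent p -> idempotent_equiv p 1 -> p = 1.

End dedekind_finite.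
Arguments dedekind_finite A : clear implicits.

(* Norms of normed modules over [R[i]] take their values in [R[i]]; [rnorm] is
   the same norm with values in [R], where suprema and infima are available. *)
Section real_valued_norm.
Context {R : realType}.

Definition rnorm (V : normedModType R[i]) (x : V) : R := complex.Re `|x|.

Variable V : normedModType R[i].
Implicit Types x y : V.

Lemma rnormE x : `|x| = (rnorm x)%:C.
Proof. exact/esym/(@RRe_real R)/normr_real. Qed.

Lemma rnorm_ge0 x : 0 <= rnorm x.
Proof. by rewrite -(@ler0c R) -rnormE. Qed.

Lemma rnorm_leP x (M : R) : (`|x| <= M%:C) = (rnorm x <= M).
Proof. by rewrite rnormE lecR. Qed.

Lemma rnormD x y : rnorm (x + y) <= rnorm x + rnorm y.
Proof. by rewrite -rnorm_leP rmorphD/= -!rnormE ler_normD. Qed.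

Lemma rnormN x : rnorm (- x) = rnorm x.
Proof. by rewrite /rnorm normrN. Qed.

Lemma rnormB x y : rnorm (x - y) <= rnorm x + rnorm y.
Proof. by rewrite -(rnormN y) rnormD. Qed.

Lemma rdistC x y : rnorm (x - y) = rnorm (y - x).
Proof. by rewrite -opprB rnormN. Qed.

Lemma rnorm_distD z x y : rnorm (x - y) <= rnorm (x - z) + rnorm (z - y).
Proof. by apply: le_trans (rnormD _ _); rewrite addrA subrK. Qed.

Lemma rnorm0 : rnorm (0 : V) = 0.
Proof. by rewrite /rnorm normr0. Qed.

Lemma rnorm0_eq0 x : rnorm x = 0 -> x = 0.
Proof. by move=> x0; apply/normr0_eq0; rewrite rnormE x0. Qed.

Lemma rnormZ (k : R[i]) x : rnorm (k *: x) = complex.Re `|k| * rnorm x.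
Proof.
apply: (@complexI R); rewrite rmorphM -!rnormE normrZ; congr (_ * _).
exact/esym/(@RRe_real R)/normr_real.
Qed.

Lemma rnorm_lt_ball x y (e : R) : ball x e%:C y <-> rnorm (x - y) < e.
Proof. by rewrite -ball_normE /ball_/= rnormE ltcR. Qed.

Lemma gt0_realC (e : R[i]) : 0 < e -> e = (complex.Re e)%:C /\ 0 < complex.Re e.
Proof.
move=> e0; have eR : (complex.Re e)%:C = e by rewrite (@RRe_real R)// gtr0_real.
by split=> //; rewrite -(@ltcR R) eR.
Qed.

End real_valued_norm.

Section real_valued_norm_banach.
Context {R : realType}.
Variable A : unitalBanachAlgType R[i].

Lemma rnormM (x y : A) : rnorm (x * y) <= rnorm x * rnorm y.
Proof. by rewrite -rnorm_leP rmorphM/= -!rnormE normrM_le. Qed.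

Lemma rnorm1 : rnorm (1 : A) = 1.
Proof. by rewrite /rnorm banach_normr1. Qed.

End real_valued_norm_banach.

Section completeness_criterion.
Context {R : realType}.
Local Notation geo n := ((2 ^+ n)^-1 : R).

Definition geometric_complete (V : normedModType R[i]) : Prop :=
  forall C : R, exists D : R, forall u : nat -> V,
    (forall n, rnorm (u n.+1 - u n) <= C * geo n) ->
    exists l : V, forall n, rnorm (u n - l) <= D * geo n.

Lemma geo_gt0 n : 0 < geo n.
Proof. by rewrite invr_gt0 exprn_gt0. Qed.

Lemma geoS n : geo n = geo n.+1 + geo n.+1.
Proof. by rewrite exprS invfM; lra. Qed.

Lemma geo_lt (C e : R) : 0 < e -> exists n, C * geo n < e.
Proof.
move=> e0; have [C0|C0] := leP C 0.
  exists 0%N; apply: le_lt_trans e0.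
  by rewrite mulr_le0_ge0// ltW// geo_gt0.
have [n nP] : exists n : nat, C / e < n%:R.
  by exists (Num.bound (C / e)); rewrite archi_boundP// ltW// divr_gt0.
exists n; rewrite ltr_pdivrMr ?exprn_gt0// mulrC -ltr_pdivrMr//.
apply: lt_trans nP _; rewrite -natrX ltr_nat; exact: ltn_expl.
Qed.

Lemma geo_nincr (C : R) m n : 0 <= C -> (m <= n)%N -> C * geo n <= C * geo m.
Proof.
move=> C0 mn; rewrite ler_wpM2l// lef_pV2 ?posrE ?exprn_gt0//.
by rewrite ler_eXn2l ?ltr1n.
Qed.

Lemma geometric_dist (V : normedModType R[i]) (C : R) (u : nat -> V) :
  (forall n, rnorm (u n.+1 - u n) <= C * geo n) ->
  forall n k, rnorm (u (n + k)%N - u n) <= C *+ 2 * (geo n - geo (n + k)%N).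
Proof.
move=> uC n; elim=> [|k IH]; first by rewrite addn0 !subrr mulr0 rnorm0.
apply: le_trans (rnorm_distD (u (n + k)%N) _ _) _.
apply: le_trans (lerD _ IH) _; first by rewrite addnS; exact: uC.
rewrite addnS [geo (n + k)%N]geoS.
by rewrite mulr2n le_eqVlt; apply/orP; left; apply/eqP; ring.
Qed.

Lemma geometric_complete_rate (V : completeNormedModType R[i]) (C : R)
    (u : nat -> V) : (forall n, rnorm (u n.+1 - u n) <= C * geo n) ->
  exists l : V, forall n, rnorm (u n - l) <= C *+ 2 * geo n.
Proof.
move=> uC.
have C0 : 0 <= C by have := le_trans (rnorm_ge0 _) (uC 0%N); rewrite expr0 invr1 mulr1.
have C20 : 0 <= C *+ 2 by rewrite mulrn_wge0.
have uD n m : (n <= m)%N -> rnorm (u m - u n) <= C *+ 2 * geo n.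
  move=> nm; rewrite -(subnKC nm); apply: le_trans (geometric_dist uC _ _) _.
  by rewrite ler_wpM2l// lerBlDr lerDl ltW// geo_gt0.
have : cauchy (u @ \oo).
  apply: cauchy_exP => e /gt0_realC[-> e0].
  have [n ne] := geo_lt (C *+ 2) e0.
  exists (u n); exists n => // m /= nm; apply/rnorm_lt_ball.
  by rewrite rdistC; apply: le_lt_trans (uD _ _ nm) ne.
move/cauchy_cvg => /cvg_ex[l ul].
exists l => n; apply/ler_addgt0Pr => e e0.
have /cvgrPdist_lt/(_ e%:C) := ul; rewrite ltcR => /(_ e0)[N _ NP].
have /NP : (N <= maxn N n)%N by rewrite leq_maxl.
rewrite rnormE ltcR => lm.
apply: le_trans (rnorm_distD (u (maxn N n)) _ _) _.
by rewrite lerD//; [rewrite rdistC uD// leq_maxr|rewrite rdistC ltW].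
Qed.

Lemma geometric_cauchy_cvg (V : normedModType R[i]) : geometric_complete V ->
  forall F : set_system V, ProperFilter F -> cauchy F -> cvg F.
Proof.
move=> Vc F FF /cauchyP Fc.
have /choice[x xP] n : exists x, F (ball x (geo n)%:C).
  by apply: Fc; rewrite ltcR geo_gt0.
have xS n : rnorm (x n.+1 - x n) <= 2 * geo n.
  have /filter_ex[y [/rnorm_lt_ball y1 /rnorm_lt_ball y2]] :
    F (ball (x n) (geo n)%:C `&` ball (x n.+1) (geo n.+1)%:C) by exact: filterI.
  apply: le_trans (rnorm_distD y _ _) _.
  rewrite mulr_natl mulr2n (rdistC y) lerD//; last exact: ltW.
  apply: le_trans (ltW y2) _; rewrite [leRHS]geoS lerDl ltW// geo_gt0//.
have [D /(_ _ xS)[l lD]] := Vc 2.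
apply/cvg_ex; exists l; apply/cvgrPdist_lt => e /gt0_realC[-> e0].
have [n] := geo_lt (D + 1) e0.
rewrite mulrDl mul1r => ne.
apply: filterS (xP n) => y /rnorm_lt_ball xy; rewrite rnormE ltcR.
apply: le_lt_trans (rnorm_distD (x n) _ _) _.
by apply: lt_trans ne; rewrite ler_ltD// rdistC.
Qed.

End completeness_criterion.

Section sequence_algebra.
Context {K : numFieldType}.
Variable A : nat -> unitalBanachAlgType K.

Definition seq_alg : Type := forall n, A n.

HB.instance Definition _ := Choice.on seq_alg.

Implicit Types a b c : seq_alg.

Fact seq_addA : associative (fun a b => (fun n => a n + b n) : seq_alg).
Proof. by move=> a b c; apply: functional_extensionality_dep => n; exact: addrA. Qed.
Fact seq_addC : commutative (fun a b => (fun n => a n + b n) : seq_alg).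
Proof. by move=> a b; apply: functional_extensionality_dep => n; exact: addrC. Qed.
Fact seq_add0 : left_id (fun=> 0) (fun a b => (fun n => a n + b n) : seq_alg).
Proof. by move=> a; apply: functional_extensionality_dep => n; exact: add0r. Qed.
Fact seq_addN : left_inverse (fun=> 0) (fun a => (fun n => - a n) : seq_alg)
  (fun a b => (fun n => a n + b n) : seq_alg).
Proof. by move=> a; apply: functional_extensionality_dep => n; exact: addNr. Qed.
HB.instance Definition _ :=
  GRing.isZmodule.Build seq_alg seq_addA seq_addC seq_add0 seq_addN.

Fact seq_mulA : associative (fun a b => (fun n => a n * b n) : seq_alg).
Proof. by move=> a b c; apply: functional_extensionality_dep => n; exact: mulrA. Qed.
Fact seq_mul1x : left_id (fun=> 1) (fun a b => (fun n => a n * b n) : seq_alg).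
Proof. by move=> a; apply: functional_extensionality_dep => n; exact: mul1r. Qed.
Fact seq_mulx1 : right_id (fun=> 1) (fun a b => (fun n => a n * b n) : seq_alg).
Proof. by move=> a; apply: functional_extensionality_dep => n; exact: mulr1. Qed.
Fact seq_mulDl :
  left_distributive (fun a b => (fun n => a n * b n) : seq_alg) +%R.
Proof. by move=> a b c; apply: functional_extensionality_dep => n; exact: mulrDl. Qed.
Fact seq_mulDr :
  right_distributive (fun a b => (fun n => a n * b n) : seq_alg) +%R.
Proof. by move=> a b c; apply: functional_extensionality_dep => n; exact: mulrDr. Qed.
Fact seq_1_neq0 : (fun=> 1) != 0 :> seq_alg.
Proof.
apply/eqP => /(congr1 (fun a : seq_alg => a 0%N)) /eqP.
by apply/negP; exact: oner_neq0.
Qed.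
HB.instance Definition _ := GRing.Zmodule_isNzRing.Build seq_alg
  seq_mulA seq_mul1x seq_mulx1 seq_mulDl seq_mulDr seq_1_neq0.

Definition seq_scale (k : K) a : seq_alg := fun n => k *: a n.
Fact seq_scaleA k l a : seq_scale k (seq_scale l a) = seq_scale (k * l) a.
Proof. by apply: functional_extensionality_dep => n; exact: scalerA. Qed.
Fact seq_scale1 : left_id 1 seq_scale.
Proof. by move=> a; apply: functional_extensionality_dep => n; exact: scale1r. Qed.
Fact seq_scaleDr : right_distributive seq_scale +%R.
Proof. by move=> k a b; apply: functional_extensionality_dep => n; exact: scalerDr. Qed.
Fact seq_scaleDl a : {morph seq_scale^~ a : k l / k + l}.
Proof. by move=> k l; apply: functional_extensionality_dep => n; exact: scalerDl. Qed.
HB.instance Definition _ := GRing.Zmodule_isLmodule.Build K seq_alg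
  seq_scaleA seq_scale1 seq_scaleDr seq_scaleDl.

Fact seq_scaleAl (k : K) a b : k *: (a * b) = (k *: a) * b.
Proof. by apply: functional_extensionality_dep => n; exact: scalerAl. Qed.
Fact seq_scaleAr (k : K) a b : k *: (a * b) = a * (k *: b).
Proof. by apply: functional_extensionality_dep => n; exact: scalerAr. Qed.
HB.instance Definition _ := GRing.Lmodule_isLalgebra.Build K seq_alg seq_scaleAl.
HB.instance Definition _ := GRing.Lalgebra_isAlgebra.Build K seq_alg seq_scaleAr.

End sequence_algebra.

Section linfty.
Context {R : realType}.
Variable A : nat -> unitalBanachAlgType R[i].

Definition bounded_seq : pred (seq_alg A) :=
  fun a => `[< exists M : R, forall n, `|a n| <= M%:C >].

Lemma bounded_seqP (a : seq_alg A) :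
  reflect (exists M : R, forall n, rnorm (a n) <= M) (a \in bounded_seq).
Proof.
by apply: (iffP (asboolP _)) => -[M aM]; exists M => n; move: (aM n);
  rewrite rnorm_leP.
Qed.

Fact bounded_seq_subalg : GRing.subsemialg_closed bounded_seq.
Proof.
split.
- by apply/bounded_seqP; exists 1 => n; rewrite rnorm1.
- split; first by apply/bounded_seqP; exists 0 => n; rewrite rnorm0.
  move=> a b /bounded_seqP[M aM] /bounded_seqP[N bN]; apply/bounded_seqP.
  by exists (M + N) => n; apply: le_trans (rnormD _ _) _; rewrite lerD.
- move=> k a /bounded_seqP[M aM]; apply/bounded_seqP.
  exists (complex.Re `|k| * M) => n; rewrite rnormZ ler_wpM2l//.
  exact: (rnorm_ge0 (k : R[i]^o)).
- move=> a b /bounded_seqP[M aM] /bounded_seqP[N bN]; apply/bounded_seqP.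
  exists (M * N) => n; apply: le_trans (rnormM _ _) _.
  by rewrite ler_pM// rnorm_ge0.
Qed.

Record linfty := Linfty { linfty_seq : seq_alg A; _ : bounded_seq linfty_seq }.

HB.instance Definition _ := [isSub for linfty_seq].
HB.instance Definition _ := [Choice of linfty by <:].
HB.instance Definition _ := GRing.isSubalgClosed.Build R[i] (seq_alg A)
  bounded_seq bounded_seq_subalg.
HB.instance Definition _ := [SubChoice_isSubAlgebra of linfty by <:].

Implicit Types a b c : linfty.

Definition supnorm a : R := sup (range (fun n => rnorm (val a n))).

Lemma supnorm_ge a n : rnorm (val a n) <= supnorm a.
Proof.
apply: ub_le_sup; last by exists n.
by have /bounded_seqP[M aM] := valP a; exists M => _ [k _ <-].
Qed.

Lemma supnorm_le a (M : R) : (forall n, rnorm (val a n) <= M) -> supnorm a <= M.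
Proof.
move=> aM; apply: ge_sup; first by exists (rnorm (val a 0%N)), 0%N.
by move=> _ [n _ <-].
Qed.

Lemma supnorm_ge0 a : 0 <= supnorm a.
Proof. exact: le_trans (rnorm_ge0 _) (supnorm_ge a 0%N). Qed.

Definition linfty_norm a : R[i] := (supnorm a)%:C.

Fact linfty_normD a b : linfty_norm (a + b) <= linfty_norm a + linfty_norm b.
Proof.
rewrite /linfty_norm -rmorphD lecR; apply: supnorm_le => n.
by apply: le_trans (rnormD _ _) _; rewrite lerD ?supnorm_ge.
Qed.

Fact linfty_norm0_eq0 a : linfty_norm a = 0 -> a = 0.
Proof.
move=> /complexI a0; apply/val_inj/functional_extensionality_dep => n.
apply: rnorm0_eq0; apply/eqP; rewrite eq_le rnorm_ge0 andbT -a0.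
exact: supnorm_ge.
Qed.

Lemma supnormZ_le (k : R[i]) a : supnorm (k *: a) <= complex.Re `|k| * supnorm a.
Proof.
apply: supnorm_le => n; rewrite [X in rnorm X]/(k *: (val a n)) rnormZ.
by rewrite ler_wpM2l ?supnorm_ge//; exact: (rnorm_ge0 (k : R[i]^o)).
Qed.

Fact linfty_normZ (k : R[i]) a : linfty_norm (k *: a) = `|k| * linfty_norm a.
Proof.
rewrite (rnormE (k : R[i]^o)) /linfty_norm -rmorphM; congr _%:C.
apply/eqP; rewrite eq_le supnormZ_le/=.
have [->|k0] := eqVneq k 0; first by rewrite rnorm0 mul0r supnorm_ge0.
have k1 : 0 < rnorm (k : R[i]^o) by rewrite -(@ltcR R) -rnormE normr_gt0.
rewrite -ler_pdivlMl//; apply: supnorm_le => n.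
rewrite ler_pdivlMl//; apply: le_trans (supnorm_ge _ n).
by rewrite [X in _ <= rnorm X]/(k *: (val a n)) rnormZ.
Qed.

HB.instance Definition _ := @Lmodule_isNormed.Build R[i] linfty linfty_norm
  linfty_normD linfty_normZ linfty_norm0_eq0.

Lemma rnorm_linfty a : rnorm a = supnorm a. Proof. by []. Qed.

Lemma linfty_geometric : geometric_complete linfty.
Proof.
move=> C; exists (C *+ 2) => u uC.
have lP n : exists l, forall k, rnorm (val (u k) n - l) <= C *+ 2 * (2 ^+ k)^-1.
  apply: geometric_complete_rate => k.
  exact: le_trans (supnorm_ge (u k.+1 - u k) n) (uC k).
pose l : seq_alg A := fun n => sval (cid (lP n)).
have lP' n k : rnorm (val (u k) n - l n) <= C *+ 2 * (2 ^+ k)^-1.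
  exact: svalP (cid (lP n)) k.
have lb : bounded_seq l.
  apply/bounded_seqP; exists (C *+ 2 * (2 ^+ 0)^-1 + supnorm (u 0%N)) => n.
  rewrite -(subrK (val (u 0%N) n) (l n)); apply: le_trans (rnormD _ _) _.
  by rewrite lerD ?supnorm_ge// rdistC lP'.
by exists (Linfty lb) => k; apply: supnorm_le => n; exact: lP'.
Qed.

HB.instance Definition _ :=
  Uniform_isComplete.Build linfty (geometric_cauchy_cvg linfty_geometric).

Fact linfty_normM a b : `|a * b| <= `|a| * `|b|.
Proof.
rewrite !rnormE -rmorphM lecR; apply: supnorm_le => n.
apply: le_trans (rnormM _ _) _.
by rewrite ler_pM ?rnorm_ge0// supnorm_ge.
Qed.

Fact linfty_norm1 : `|1 : linfty| = 1.
Proof.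
rewrite rnormE; congr _%:C; apply/eqP; rewrite eq_le; apply/andP; split.
  by apply: supnorm_le => n; rewrite rnorm1.
by apply: le_trans (supnorm_ge _ 0%N); rewrite rnorm1.
Qed.

HB.instance Definition _ :=
  CompleteNormedModule_isUnitalBanachAlgebra.Build R[i] linfty
    (@mulrA linfty) (@mul1r linfty) (@mulr1 linfty) (@mulrDl linfty)
    (@mulrDr linfty) (@scalerAl R[i] linfty) (@scalerAr R[i] linfty)
    linfty_normM linfty_norm1.

End linfty.

Section ultraproduct.
Context {R : realType}.
Variables (A : nat -> unitalBanachAlgType R[i]) (U : set_system nat).

(* The proof that [U] is an ultrafilter is not used by the formula; it is an
   argument so that the ideal structure of [c_U] can be inferred from it. *)
Definition c_U of UltraFilter U : {pred linfty A} :=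
  fun a => `[< `|val a n| @[n --> U] --> 0 >].

Context {FU : UltraFilter U}.
Implicit Types a b c : linfty A.

Lemma c_UP a :
  reflect (forall e : R, 0 < e -> \forall n \near U, rnorm (val a n) < e)
          (a \in c_U FU).
Proof.
apply: (iffP (asboolP _)) => [/cvgr0Pnorm_lt aU e e0|aU].
  have := aU e%:C; rewrite ltcR => /(_ e0); apply: filterS => n.
  by rewrite normr_id rnormE ltcR.
apply/cvgr0Pnorm_lt => e /gt0_realC[-> e0].
by apply: filterS (aU _ e0) => n; rewrite normr_id rnormE ltcR.
Qed.

Fact c_U_zmod_closed : zmod_closed (c_U FU).
Proof.
split.
  by apply/c_UP => e e0; apply: nearW => n; rewrite rnorm0.
move=> a b /c_UP aU /c_UP bU; apply/c_UP => e e0.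
have e20 : 0 < e / 2 by rewrite divr_gt0.
apply: filterS2 (aU _ e20) (bU _ e20) => n an bn.
apply: le_lt_trans (rnormB _ _) _.
by rewrite [ltRHS]splitr ltrD.
Qed.

Lemma c_U_mulr a b : a \in c_U FU -> a * b \in c_U FU.
Proof.
move=> /c_UP aU; apply/c_UP => e e0.
have b0 : 0 < supnorm b + 1 by rewrite ltr_wpDl// supnorm_ge0.
apply: filterS (aU _ (divr_gt0 e0 b0)) => n an.
apply: le_lt_trans (rnormM _ _) _.
apply: le_lt_trans (ler_wpM2l (rnorm_ge0 _) (supnorm_ge b n)) _.
apply: le_lt_trans (_ : rnorm (val a n) * (supnorm b + 1) < _).
  by rewrite ler_wpM2l ?rnorm_ge0// lerDl.
by rewrite -ltr_pdivlMr.
Qed.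

Lemma c_U_mull a b : b \in c_U FU -> a * b \in c_U FU.
Proof.
move=> /c_UP bU; apply/c_UP => e e0.
have a0 : 0 < supnorm a + 1 by rewrite ltr_wpDl// supnorm_ge0.
apply: filterS (bU _ (divr_gt0 e0 a0)) => n bn.
apply: le_lt_trans (rnormM _ _) _.
apply: le_lt_trans (ler_wpM2r (rnorm_ge0 _) (supnorm_ge a n)) _.
apply: le_lt_trans (_ : (supnorm a + 1) * rnorm (val b n) < _).
  by rewrite ler_wpM2r ?rnorm_ge0// lerDl.
by rewrite mulrC -ltr_pdivlMr.
Qed.

Lemma c_U_scale (k : R[i]) a : a \in c_U FU -> k *: a \in c_U FU.
Proof. by rewrite -mulr_algl; exact: c_U_mull. Qed.

Lemma c_U_1 : 1 \notin c_U FU.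
Proof.
apply/negP => /c_UP/(_ 1 ltr01)/filter_ex[n].
by rewrite [X in rnorm X]/(1 : A n) rnorm1 ltxx.
Qed.

Lemma c_U_closed a :
  (forall e : R, 0 < e -> exists2 c, c \in c_U FU & rnorm (a - c) < e) ->
  a \in c_U FU.
Proof.
move=> ac; apply/c_UP => e e0.
have e20 : 0 < e / 2 by rewrite divr_gt0.
have [c /c_UP/(_ _ e20) cU ace] := ac _ e20.
apply: filterS cU => n cn.
rewrite -(subrK (val c n) (val a n)).
apply: le_lt_trans (rnormD _ _) _; rewrite [ltRHS]splitr ltrD//.
exact: le_lt_trans (supnorm_ge (a - c) n) ace.
Qed.

HB.instance Definition _ :=
  GRing.isZmodClosed.Build (linfty A) (c_U FU) c_U_zmod_closed.

Definition ultraproduct : Type := {ideal_quot c_U FU}.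

HB.instance Definition _ := ZmodQuotient.on ultraproduct.

Local Notation up := (\pi_ultraproduct).
Implicit Types x y z : ultraproduct.

Lemma up_eqP a b : up a = up b <-> a - b \in c_U FU.
Proof. by rewrite Quotient.idealrBE; split => [->//|/eqP]. Qed.

Lemma upD a b : up (a + b) = up a + up b. Proof. exact: raddfD. Qed.
Lemma upB a b : up (a - b) = up a - up b. Proof. exact: raddfB. Qed.
Lemma upK x : up (repr x) = x. Proof. exact: reprK. Qed.
Lemma up_surj x : exists a, x = up a. Proof. by exists (repr x); rewrite upK. Qed.

Definition umul x y : ultraproduct := up (repr x * repr y).
Definition uscale (k : R[i]) x : ultraproduct := up (k *: repr x).

Lemma upM a b : up (a * b) = umul (up a) (up b).
Proof.
apply/up_eqP.
have -> : a * b - repr (up a) * repr (up b) =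
    (a - repr (up a)) * b + repr (up a) * (b - repr (up b)).
  by rewrite mulrBl mulrBr addrA subrK.
by apply: rpredD; [apply: c_U_mulr|apply: c_U_mull]; apply/up_eqP; rewrite upK.
Qed.

Lemma upZ (k : R[i]) a : up (k *: a) = uscale k (up a).
Proof.
apply/up_eqP; rewrite -scalerBr; apply: c_U_scale.
by apply/up_eqP; rewrite upK.
Qed.

Fact umulA : associative umul.
Proof.
by move=> x y z; rewrite -[x]upK -[y]upK -[z]upK -!upM mulrA.
Qed.
Fact umul1x : left_id (up 1) umul.
Proof. by move=> x; rewrite -[x]upK -!upM mul1r. Qed.
Fact umulx1 : right_id (up 1) umul.
Proof. by move=> x; rewrite -[x]upK -!upM mulr1. Qed.
Fact umulDl : left_distributive umul +%R.
Proof.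
by move=> x y z; rewrite -[x]upK -[y]upK -[z]upK -upD -!upM -upD mulrDl.
Qed.
Fact umulDr : right_distributive umul +%R.
Proof.
by move=> x y z; rewrite -[x]upK -[y]upK -[z]upK -upD -!upM -upD mulrDr.
Qed.
Fact up1_neq0 : up 1 != 0.
Proof.
rewrite -(raddf0 (up : {additive _ -> _})).
by apply/eqP => /up_eqP; rewrite subr0; apply/negP; exact: c_U_1.
Qed.

HB.instance Definition _ := GRing.Zmodule_isNzRing.Build ultraproduct
  umulA umul1x umulx1 umulDl umulDr up1_neq0.

Fact uscaleA k l x : uscale k (uscale l x) = uscale (k * l) x.
Proof. by rewrite -[x]upK -!upZ scalerA. Qed.
Fact uscale1 : left_id 1 uscale.
Proof. by move=> x; rewrite -[x]upK -!upZ scale1r. Qed.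
Fact uscaleDr : right_distributive uscale +%R.
Proof.
by move=> k x y; rewrite -[x]upK -[y]upK -upD -!upZ -upD scalerDr.
Qed.
Fact uscaleDl x : {morph uscale^~ x : k l / k + l}.
Proof. by move=> k l; rewrite -[x]upK -!upZ -upD scalerDl. Qed.

HB.instance Definition _ := GRing.Zmodule_isLmodule.Build R[i] ultraproduct
  uscaleA uscale1 uscaleDr uscaleDl.

Fact uscaleAl (k : R[i]) x y : uscale k (umul x y) = umul (uscale k x) y.
Proof. by rewrite -[x]upK -[y]upK -upM -!upZ -upM scalerAl. Qed.
Fact uscaleAr (k : R[i]) x y : uscale k (umul x y) = umul x (uscale k y).
Proof. by rewrite -[x]upK -[y]upK -upM -!upZ -upM scalerAr. Qed.
HB.instance Definition _ := GRing.Lmodule_isLalgebra.Build R[i] ultraproduct uscaleAl.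
HB.instance Definition _ := GRing.Lalgebra_isAlgebra.Build R[i] ultraproduct uscaleAr.

Lemma upME a b : up (a * b) = up a * up b. Proof. exact: upM. Qed.
Lemma upZE (k : R[i]) a : up (k *: a) = k *: up a. Proof. exact: upZ. Qed.

(* The infimum of the norms of the lifts of [x] to [linfty A]. *)
Definition quotient_norm x : R := inf [set rnorm a | a in [set a | up a = x]].

Lemma quotient_norm_le a : quotient_norm (up a) <= rnorm a.
Proof.
by apply: ge_inf; [exists 0 => _ [b _ <-]; exact: rnorm_ge0|exists a].
Qed.

Lemma quotient_norm_ge0 x : 0 <= quotient_norm x.
Proof.
apply: lb_le_inf; first by exists (rnorm (repr x)), (repr x) => //; exact: upK.
by move=> _ [b _ <-]; exact: rnorm_ge0.
Qed.

Lemma quotient_norm_lift x (M : R) : quotient_norm x < M ->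
  exists2 a, up a = x & rnorm a < M.
Proof.
move=> /inf_lt[|_ [a ax <-] aM]; last by exists a.
by exists (rnorm (repr x)), (repr x) => //; exact: upK.
Qed.

Definition ultraproduct_norm x : R[i] := (quotient_norm x)%:C.

Fact ultraproduct_normD x y :
  ultraproduct_norm (x + y) <= ultraproduct_norm x + ultraproduct_norm y.
Proof.
rewrite /ultraproduct_norm -rmorphD lecR; apply/ler_addgt0Pr => e e0.
have e20 : 0 < e / 2 by rewrite divr_gt0.
have [a <- ax] : exists2 a, up a = x & rnorm a < quotient_norm x + e / 2.
  by apply: quotient_norm_lift; rewrite ltrDl.
have [b <- bx] : exists2 b, up b = y & rnorm b < quotient_norm y + e / 2.
  by apply: quotient_norm_lift; rewrite ltrDl.
rewrite -upD; apply: le_trans (quotient_norm_le _) _.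
apply: le_trans (rnormD _ _) _; move: ax bx; lra.
Qed.

Lemma quotient_normZ_le (k : R[i]) x :
  quotient_norm (k *: x) <= complex.Re `|k| * quotient_norm x.
Proof.
have k0 : 0 <= complex.Re `|k| := rnorm_ge0 (k : R[i]^o).
apply/ler_addgt0Pr => e e0.
have k1 : 0 < complex.Re `|k| + 1 by rewrite ltr_wpDl.
have [a <- ax] : exists2 a, up a = x &
    rnorm a < quotient_norm x + e / (complex.Re `|k| + 1).
  by apply: quotient_norm_lift; rewrite ltrDl divr_gt0.
rewrite -upZE.
apply: le_trans (quotient_norm_le _) _; rewrite rnormZ.
apply: le_trans (ler_wpM2l k0 (ltW ax)) _.
rewrite mulrDr lerD2l mulrCA ler_piMr ?(ltW e0)//.
by rewrite ler_pdivrMr// mul1r lerDl.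
Qed.

Fact ultraproduct_normZ (k : R[i]) x :
  ultraproduct_norm (k *: x) = `|k| * ultraproduct_norm x.
Proof.
rewrite (rnormE (k : R[i]^o)) /ultraproduct_norm -rmorphM; congr _%:C.
apply/eqP; rewrite eq_le quotient_normZ_le/=.
have [->|k0] := eqVneq k 0; first by rewrite rnorm0 mul0r quotient_norm_ge0.
have k1 : 0 < rnorm (k : R[i]^o) by rewrite -(@ltcR R) -rnormE normr_gt0.
rewrite -ler_pdivlMl// -{1}(scale1r x) -(mulVf k0) -scalerA.
apply: le_trans (quotient_normZ_le _ _) _.
rewrite ler_wpM2r ?quotient_norm_ge0// -(@lecR R) fmorphV.
by rewrite -[complex.Re `|k^-1|]/(rnorm (k^-1 : R[i]^o)) -!rnormE normfV.
Qed.

Fact ultraproduct_norm0_eq0 x : ultraproduct_norm x = 0 -> x = 0.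
Proof.
move=> /complexI x0; rewrite -(upK x) -(raddf0 (up : {additive _ -> _})).
apply/up_eqP; rewrite subr0; apply: c_U_closed => e e0.
have [a ax ae] : exists2 a, up a = x & rnorm a < e.
  by apply: quotient_norm_lift; rewrite x0.
exists (repr x - a); first by apply/up_eqP; rewrite upK.
by rewrite opprB addrC subrK.
Qed.

HB.instance Definition _ := @Lmodule_isNormed.Build R[i] ultraproduct
  ultraproduct_norm ultraproduct_normD ultraproduct_normZ ultraproduct_norm0_eq0.

Lemma ultraproduct_geometric : geometric_complete ultraproduct.
Proof.
move=> C; exists ((C + 1) *+ 2) => u uC.
have /choice[b bP] n : exists b, up b = u n.+1 - u n /\
    rnorm b < (C + 1) * (2 ^+ n)^-1.
  have [|b bu bn] := @quotient_norm_lift (u n.+1 - u n) ((C + 1) * (2 ^+ n)^-1).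
    by apply: le_lt_trans (uC n) _; rewrite ltr_pM2r ?ltrDl// geo_gt0.
  by exists b.
pose s n := repr (u 0%N) + \sum_(k < n) b k.
have us n : up (s n) = u n.
  elim: n => [|n IH]; first by rewrite /s big_ord0 addr0 upK.
  rewrite /s big_ord_recr/= addrA upD IH; have [-> _] := bP n.
  by rewrite addrC subrK.
have [n|l lP] := @geometric_complete_rate _ (linfty A) (C + 1) s.
  rewrite /s big_ord_recr/= addrA [_ + b n]addrC addrK.
  by have [_ /ltW] := bP n.
exists (up l) => n; rewrite -us -upB.
exact: le_trans (quotient_norm_le _) (lP n).
Qed.

HB.instance Definition _ := Uniform_isComplete.Build ultraproduct
  (geometric_cauchy_cvg ultraproduct_geometric).

Lemma quotient_normM x y :
  quotient_norm (x * y) <= quotient_norm x * quotient_norm y.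
Proof.
have [x0 y0] := (quotient_norm_ge0 x, quotient_norm_ge0 y).
apply/ler_addgt0Pr => e e0.
pose d := Num.min 1 (e / (quotient_norm x + quotient_norm y + 1)).
have s0 : 0 < quotient_norm x + quotient_norm y + 1.
  by rewrite ltr_wpDl// addr_ge0.
have d0 : 0 < d by rewrite lt_min ltr01 divr_gt0.
have [a ax an] : exists2 a, up a = x & rnorm a < quotient_norm x + d.
  by apply: quotient_norm_lift; rewrite ltrDl.
have [b bx bn] : exists2 b, up b = y & rnorm b < quotient_norm y + d.
  by apply: quotient_norm_lift; rewrite ltrDl.
have -> : x * y = up (a * b) by rewrite upME ax bx.
apply: le_trans (quotient_norm_le _) _.
apply: le_trans (@rnormM _ (linfty A) _ _) _.
apply: le_trans (ler_pM (rnorm_ge0 _) (rnorm_ge0 _) (ltW an) (ltW bn)) _.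
have d1 : d <= 1 by rewrite /d ge_min lexx.
have de : d * (quotient_norm x + quotient_norm y + 1) <= e.
  by rewrite -ler_pdivlMr// /d ge_min lexx orbT.
apply: le_trans (_ : _ <= quotient_norm x * quotient_norm y +
    d * (quotient_norm x + quotient_norm y + 1)) _; last by rewrite lerD2l.
have dd : d * d <= d * 1 by rewrite ler_wpM2l// ltW.
by move: dd; set qa := quotient_norm _; set qb := quotient_norm _; lra.
Qed.

Fact ultraproduct_normM x y : `|x * y| <= `|x| * `|y|.
Proof. by rewrite !rnormE -rmorphM lecR; exact: quotient_normM. Qed.

Fact ultraproduct_norm1 : `|1 : ultraproduct| = 1.
Proof.
rewrite rnormE; congr _%:C; apply/eqP; rewrite eq_le; apply/andP; split.
  by apply: le_trans (quotient_norm_le (1 : linfty A)) _; rewrite rnorm1.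
have n1 : 0 < rnorm (1 : ultraproduct).
  by rewrite -(@ltcR R) -rnormE normr_gt0 oner_neq0.
by have := quotient_normM 1 1; rewrite mulr1 -{1}[quotient_norm 1]mulr1 ler_pM2l.
Qed.

HB.instance Definition _ :=
  CompleteNormedModule_isUnitalBanachAlgebra.Build R[i] ultraproduct
    (@mulrA ultraproduct) (@mul1r ultraproduct) (@mulr1 ultraproduct)
    (@mulrDl ultraproduct) (@mulrDr ultraproduct)
    (@scalerAl R[i] ultraproduct) (@scalerAr R[i] ultraproduct)
    ultraproduct_normM ultraproduct_norm1.

End ultraproduct.

Arguments ultraproduct {R} A U {FU}.

(* Main.v *)
(** If [b a = 1] in the ultraproduct, lift [a] and [b] to bounded sequences: [b_n a_n] is close to [1]
    for [U]-many [n], hence has an inverse [c_n] of norm at most [2] by the Neumann series. Then [c_n b_n]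
    is a left inverse of [a_n], so [a_n c_n b_n = 1] as soon as [A_n] is Dedekind-finite, and
    [1 - a_n b_n = a_n c_n (1 - b_n a_n) b_n] tends to [0] along [U]. *)

Require Import Defs.
From HB Require Import structures.
From mathcomp Require Import all_boot all_order all_algebra.
From mathcomp Require Import complex.
From mathcomp Require Import all_classical all_reals all_analysis.
Import Order.TTheory GRing.Theory Num.Theory.
Import numFieldNormedType.Exports.
Set Implicit Arguments.
Unset Strict Implicit.
Unset Printing Implicit Defensive.
Local Open Scope classical_set_scope.
Local Open Scope ring_scope.
Local Open Scope complex_scope.

(** [a * b] is an idempotent equivalent to [b * a = 1]. *)
Lemma dedekind_finite_mul1C (B : nzRingType) (a b : B) :
  dedekind_finite B -> b * a = 1 -> a * b = 1.
Proof.
move=> Bfin ba1; apply: Bfin; last by exists a, b.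
by rewrite /Defs.idempotent mulrA -(mulrA a) ba1 mulr1.
Qed.

Lemma le0_geo {R : realType} (C x : R) :
  (forall n, x <= C * (2 ^+ n)^-1) -> x <= 0.
Proof.
move=> xC; rewrite leNgt; apply/negP => /(geo_lt C)[n].
by rewrite ltNge xC.
Qed.

Lemma rnormX_le {R : realType} (B : unitalBanachAlgType R[i]) (x : B) n :
  rnorm (x ^+ n) <= rnorm x ^+ n.
Proof.
elim: n => [|n IH]; first by rewrite !expr0 rnorm1.
by rewrite !exprS; apply: le_trans (rnormM _ _) _; rewrite ler_wpM2l ?rnorm_ge0.
Qed.

(** [c] is the limit of the partial sums of the powers of [1 - y]. *)
Lemma neumann_linv {R : realType} (B : unitalBanachAlgType R[i]) (y : B) :
  rnorm (1 - y) <= 2^-1 -> exists2 c, c * y = 1 & rnorm c <= 2.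
Proof.
set x := 1 - y => x2.
have yE : y = 1 - x by rewrite /x opprB addrC subrK.
have xn n : rnorm (x ^+ n) <= (2 ^+ n)^-1.
  apply: le_trans (rnormX_le _ _) _; rewrite -exprVn.
  by rewrite lerXn2r// nnegrE ?rnorm_ge0// invr_ge0.
pose u n := \sum_(k < n) x ^+ k.
(* The increments [x ^+ n] have norm at most [1 * (2 ^+ n)^-1], so [u n] lies within
   [2 * (2 ^+ n)^-1] of [l]. *)
have [n|l ul] := @geometric_complete_rate R B 1 u.
  by rewrite /u big_ord_recr/= [_ + x ^+ n]addrC addrK mul1r.
have uy n : u n * y = 1 - x ^+ n.
  rewrite yE /u; elim: n => [|n IH].
    by rewrite big_ord0 mul0r expr0 subrr.
  rewrite big_ord_recr/= mulrDl IH mulrBr mulr1 exprSr.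
  by rewrite addrA subrK.
exists l; last first.
  (* The empty partial sum is [0], so the rate at [0] bounds the norm of [l] itself. *)
  have := ul 0%N; rewrite /u big_ord0 rdistC subr0.
  by rewrite expr0 invr1 mulr1.
apply/subr0_eq/rnorm0_eq0/eqP.
(* [2 * rnorm y] accounts for [(u n - l) * y], and [1] for [x ^+ n]. *)
rewrite eq_le rnorm_ge0 andbT; apply: (@le0_geo R (2 * rnorm y + 1)) => n.
have -> : l * y - 1 = - ((u n - l) * y) - x ^+ n.
  by rewrite mulrBl uy !opprB addrA addrAC addrK.
apply: le_trans (rnormB _ _) _; rewrite rnormN [leRHS]mulrDl mul1r lerD//.
apply: le_trans (rnormM _ _) _; rewrite mulrAC.
by rewrite ler_wpM2r ?rnorm_ge0.
Qed.

Lemma dedekind_finite_dist {R : realType} (B : unitalBanachAlgType R[i])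
    (a b : B) : dedekind_finite B -> rnorm (1 - b * a) <= 2^-1 ->
  rnorm (1 - a * b) <= 2 * rnorm a * rnorm b * rnorm (1 - b * a).
Proof.
move=> Bfin /neumann_linv[c cba c2].
have acb : a * (c * b) = 1 by apply: dedekind_finite_mul1C => //; rewrite -mulrA.
(* As [c * (b * a) = 1], the right side is [a * (c - 1) * b = a * c * b - a * b]. *)
have -> : 1 - a * b = a * (c * (1 - b * a)) * b.
  by rewrite mulrBr cba mulr1 mulrBr mulr1 mulrBl -[a * c * b]mulrA acb.
apply: le_trans (rnormM _ _) _.
rewrite [leRHS]mulrAC ler_wpM2r ?rnorm_ge0//.
apply: le_trans (rnormM _ _) _.
rewrite [2 * _]mulrC -mulrA ler_wpM2l ?rnorm_ge0//.
by apply: le_trans (rnormM _ _) _; rewrite ler_wpM2r ?rnorm_ge0.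
Qed.

Theorem theorem3p19 (R : realType) (A : nat -> unitalBanachAlgType R[i])
    (U : set_system nat) (FU : UltraFilter U)
    (U_nonprincipal : forall n : nat, U <> principal_filter n)
    (A_finite : U [set n | dedekind_finite (A n)]) :
  dedekind_finite (ultraproduct A U).
Proof.
move=> p _ [x [y [-> ]]].
have [a ->] := up_surj x; have [b ->] := up_surj y.
rewrite -!upME => /up_eqP/c_UP ba1; apply/esym/up_eqP/c_UP => e e0.
(* This bounds the factor in [dedekind_finite_dist] uniformly in [n]; the [+ 1] makes it positive,
   so that [e / C] is a valid threshold. *)
pose C := 2 * supnorm a * supnorm b + 1.
have C0 : 0 < C by rewrite ltr_wpDl// !mulr_ge0// supnorm_ge0.
have h0 : 0 < 2^-1 :> R by rewrite invr_gt0.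
apply: filterS3 A_finite (ba1 _ h0) (ba1 _ (divr_gt0 e0 C0)) => n /= An ban bae.
apply: le_lt_trans (dedekind_finite_dist An (ltW ban)) _.
rewrite ltr_pdivlMr// mulrC in bae; apply: le_lt_trans bae.
rewrite ler_wpM2r ?rnorm_ge0//.
apply: le_trans (_ : _ <= 2 * supnorm a * supnorm b) _; last by rewrite lerDl.
by rewrite -!mulrA ler_wpM2l// ler_pM ?rnorm_ge0 ?supnorm_ge.
Qed.
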